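(* Let $\mathcal{X}$ be a finite alphabet, $p_X$ a probability distribution on $\mathcal{X}$, and $\{\rho_x\}_{x\in\mathcal{X}}$ density operators on a finite-dimensional Hilbert space $\mathcal{H}$, with expected state $\rho\equiv\sum_{x}p_X(x)\rho_x$. Suppose there exist an orthogonal projector $\Pi$ (the ''code subspace projector'') and orthogonal projectors $\{\Pi_x\}_{x\in\mathcal{X}}$ (the ''codeword subspace projectors'') on $\mathcal{H}$, and constants $D,d>0$, $0<\epsilon\le 1/2$, such that for all $x\in\mathcal{X}$: $$\mathrm{Tr}\{\Pi\rho_x\}\ge 1-\epsilon,\quad \mathrm{Tr}\{\Pi_x\rho_x\}\ge 1-\epsilon,\quad \Pi_x\rho_x\Pi_x\ge \tfrac{1}{d}\Pi_x,\quad \Pi\rho\Pi\le \tfrac{1}{D}\Pi,\quad [\Pi_x,\rho_x]=0.$$ Let $\mathcal{M}=\{1,\dots,|\mathcal{M}|\}$ be a message set and let $\mathcal{C}=\{c_m\}_{m\in\mathcal{M}}$ be a random code whose codewords $c_m\in\mathcal{X}$ are drawn independently, each according to $p_X$. For a code $\mathcal{C}$ define the sequential decoding POVM $\{\Lambda_m\}_{m\in\mathcal{M}}$ by $$\Lambda_m\equiv \bar{Q}_{c_1}\cdots\bar{Q}_{c_{m-1}}\,\bar{\Pi}_{c_m}\,\bar{Q}_{c_{m-1}}\cdots\bar{Q}_{c_1},$$ where $Q_x\equiv I-\Pi_x$ and $\bar\Theta\equiv\Pi\Theta\Pi$ for any operator $\Theta$ (this corresponds to the receiver alternately measuring $\{\Pi,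 I-\Pi\}$ and $\{\Pi_{c_k},I-\Pi_{c_k}\}$ for $k=1,2,\dots$, declaring message $k$ at the first YES outcome of $\Pi_{c_k}$), and define the average success probability $\bar p_{\mathrm{succ}}(\mathcal{C})\equiv\frac{1}{|\mathcal{M}|}\sum_{m}\mathrm{Tr}\{\Lambda_m\rho_{c_m}\}$. Then, provided $2-\exp\{d|\mathcal{M}|/D\}>0$, $$\mathbb{E}_{\mathcal{C}}\{\bar p_{\mathrm{succ}}(\mathcal{C})\}\ \ge\ \left|(1-2\epsilon)\left(2-e^{\frac{d}{D}|\mathcal{M}|}\right)\right|^2 .$$
   Context: All Hilbert spaces are finite-dimensional. Operator inequalities $A\ge B$ mean $A-B$ is positive semidefinite. $\mathbb{E}_{\mathcal{C}}$ denotes expectation over the random choice of the code. *)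

(* Defs.v *)
From Stdlib Require Import Reals.
From mathcomp Require Import ssreflect ssrfun ssrbool eqtype ssrnat seq choice fintype finfun bigop.
Set Implicit Arguments. Unset Strict Implicit. Unset Printing Implicit Defensive.
Local Open Scope R_scope.

Record C := mkC { Re : R; Im : R }.
Definition C0 : C := mkC 0 0.
Definition C1 : C := mkC 1 0.
Definition RtoC (r : R) : C := mkC r 0.
Definition Cadd (a b : C) : C := mkC (Re a + Re b) (Im a + Im b).
Definition Copp (a : C) : C := mkC (- Re a) (- Im a).
Definition Cmul (a b : C) : C :=
  mkC (Re a * Re b - Im a * Im b) (Re a * Im b + Im a * Re b).
Definition Cconj (a : C) : C := mkC (Re a) (- Im a).

Definition op (n : nat) := 'I_n -> 'I_n -> C.

Definition mid (n : nat) : op n := fun i j => if i == j then C1 else C0.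
Definition madd n (A B : op n) : op n := fun i j => Cadd (A i j) (B i j).
Definition msub n (A B : op n) : op n := fun i j => Cadd (A i j) (Copp (B i j)).
Definition mscale n (r : R) (A : op n) : op n := fun i j => Cmul (RtoC r) (A i j).
Definition mmul n (A B : op n) : op n :=
  fun i j => \big[Cadd/C0]_(k < n) Cmul (A i k) (B k j).
Definition madj n (A : op n) : op n := fun i j => Cconj (A j i).
Definition mzero n : op n := fun _ _ => C0.
Definition trace n (A : op n) : C := \big[Cadd/C0]_(i < n) A i i.

Definition hermitian n (A : op n) : Prop := forall i j, A i j = Cconj (A j i).
Definition psd n (A : op n) : Prop :=
  hermitian A /\
  forall v : 'I_n -> C,
    0 <= Re (\big[Cadd/C0]_(i < n) \big[Cadd/C0]_(j < n)
               Cmul (Cmul (Cconj (v i)) (A i j)) (v j)).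
Definition mle n (A B : op n) : Prop := psd (msub B A).

Definition density n (rho : op n) : Prop := psd rho /\ trace rho = C1.
Definition projector n (P : op n) : Prop :=
  (forall i j, mmul P P i j = P i j) /\ hermitian P.
Definition commute n (A B : op n) : Prop := forall i j, mmul A B i j = mmul B A i j.

Definition prob_dist (X : finType) (p : X -> R) : Prop :=
  (forall x, 0 <= p x) /\ \big[Rplus/0]_(x : X) p x = 1.

Definition avg_state n (X : finType) (p : X -> R) (rho : X -> op n) : op n :=
  \big[@madd n/@mzero n]_(x : X) mscale (p x) (rho x).

Definition sandw n (Pi Th : op n) : op n := mmul (mmul Pi Th) Pi.

(* Sequential decoding POVM element for message m (0-indexed: message m+1):
   Lambda_m = Qb_{c_1} ... Qb_{c_{m-1}} Pib_{c_m} Qb_{c_{m-1}} ... Qb_{c_1},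
   with Q_x = I - Pi_x and bars meaning Pi . Pi. *)
Definition seq_povm n (X : finType) (Pi : op n) (Pix : X -> op n) (M : nat)
    (c : {ffun 'I_M -> X}) (m : 'I_M) : op n :=
  let Qb := fun x => sandw Pi (msub (@mid n) (Pix x)) in
  let left  := \big[@mmul n/@mid n]_(k < M | (k < m)%N) Qb (c k) in
  let right := \big[(fun A B => @mmul n B A)/@mid n]_(k < M | (k < m)%N) Qb (c k) in
  mmul (mmul left (sandw Pi (Pix (c m)))) right.

Definition psucc n (X : finType) (Pi : op n) (Pix : X -> op n) (rho : X -> op n)
    (M : nat) (c : {ffun 'I_M -> X}) : R :=
  / INR M * \big[Rplus/0]_(m < M) Re (trace (mmul (seq_povm Pi Pix c m) (rho (c m)))).

Definition code_t (X : finType) (M : nat) := {ffun 'I_M -> X}.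

Definition expect_code (X : finType) (p : X -> R) (M : nat) (f : {ffun 'I_M -> X} -> R) : R :=
  \big[Rplus/0]_(c : code_t X M) Rmult (\big[Rmult/1]_(i < M) p (c i)) (f c).

(* Main.v *)
(** The success probability of message [m] is [Tr (A rho A^H)] with
    [A = Pi_x Pi T^H], where [x] is the codeword and [T] the product of the
    earlier failure operators.  From [Tr ((A - t) rho (A - t)^H) >= 0] it is at
    least [2 t Re Tr (A rho) - t^2], which is linear in [T].  The codewords are
    independent, so averaging replaces [T] by [Abar ^ m], with [Abar] the mean of
    [Pi (1 - Pi_x) Pi].  The hypotheses give [Pi_x <= d rho_x], hence
    [Abar >= (1 - d/D) Pi] and [Abar ^ m Pi >= (1 - d/D) ^ m Pi].  Testing this
    against the mean of [Pi_x rho_x] bounds the averaged overlap below by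
    [(1 - 2 eps) (1 - m d/D)], and [1 - m d/D >= 2 - exp (M d/D)].  Taking
    [t = (1 - 2 eps) (2 - exp (M d/D))] gives [2 t t - t^2 = t^2]. *)

From Stdlib Require Import Reals Lra.
From HB Require Import structures.
From mathcomp Require Import all_boot all_algebra Rstruct.
Require Import Defs.
Set Implicit Arguments. Unset Strict Implicit. Unset Printing Implicit Defensive.
Import GRing.Theory.
Local Open Scope ring_scope.
Delimit Scope R_scope with coqR.

(** * Complex numbers as a commutative ring, and finite sums of reals *)

Lemma C_eq (a b : C) : Re a = Re b -> Im a = Im b -> a = b.
Proof. by case: a b => [x y] [x' y'] /= -> ->. Qed.

(** Bijection with pairs of reals, through which [C] inherits the choice structure that the
    algebraic hierarchy requires. *)
Definition pair_of_C (a : C) : R * R := (Re a, Im a).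
Definition C_of_pair (u : R * R) : C := mkC u.1 u.2.
Lemma pair_of_CK : cancel pair_of_C C_of_pair.
Proof. by case. Qed.

HB.instance Definition _ := Choice.copy C (can_type pair_of_CK).

Ltac C_ring := repeat move=> ?; apply: C_eq; rewrite /=; lra.

Fact C_addA : associative Cadd. Proof. by C_ring. Qed.
Fact C_addC : commutative Cadd. Proof. by C_ring. Qed.
Fact C_add0 : left_id C0 Cadd. Proof. by C_ring. Qed.
Fact C_addN : left_inverse C0 Copp Cadd. Proof. by C_ring. Qed.
HB.instance Definition _ := GRing.isZmodule.Build C C_addA C_addC C_add0 C_addN.

Fact C_mulA : associative Cmul. Proof. by C_ring. Qed.
Fact C_mulC : commutative Cmul. Proof. by C_ring. Qed.
Fact C_mul1 : left_id C1 Cmul. Proof. by C_ring. Qed.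
Fact C_mulD : left_distributive Cmul Cadd. Proof. by C_ring. Qed.
Fact C_1neq0 : C1 != C0.
Proof. by apply/eqP => /(congr1 Re) /=; lra. Qed.
HB.instance Definition _ :=
  GRing.Zmodule_isComNzRing.Build C C_mulA C_mulC C_mul1 C_mulD C_1neq0.

Fact Cconj_is_additive : {morph Cconj : x y / x - y}.
Proof. by C_ring. Qed.
Fact Cconj_is_monoid : monoid_morphism Cconj.
Proof. by split; C_ring. Qed.
HB.instance Definition _ := GRing.isZmodMorphism.Build C C Cconj Cconj_is_additive.
HB.instance Definition _ := GRing.isMonoidMorphism.Build C C Cconj Cconj_is_monoid.

Fact RtoC_is_additive : {morph RtoC : x y / x - y}.
Proof. by move=> x y; apply: C_eq; rewrite //=; lra. Qed.
Fact RtoC_is_monoid : monoid_morphism RtoC.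
Proof. by split=> // x y; apply: C_eq; rewrite /=; rewrite /GRing.mul /=; lra. Qed.
HB.instance Definition _ := GRing.isZmodMorphism.Build R C RtoC RtoC_is_additive.
HB.instance Definition _ := GRing.isMonoidMorphism.Build R C RtoC RtoC_is_monoid.

Lemma Cconj_real r : Cconj (RtoC r) = RtoC r.
Proof. by apply: C_eq; rewrite //=; lra. Qed.

Lemma ReD (a b : C) : Re (a + b) = (Re a + Re b)%coqR.
Proof. by []. Qed.

Lemma ReZ r (a : C) : Re (RtoC r * a) = (r * Re a)%coqR.
Proof. by change (r * Re a - 0 * Im a = r * Re a)%coqR; lra. Qed.

Lemma Re_sum (I : Type) (s : seq I) (P : pred I) (F : I -> C) :
  Re (\sum_(i <- s | P i) F i) = \big[Rplus/0%coqR]_(i <- s | P i) Re (F i).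
Proof. exact: (big_morph Re ReD erefl). Qed.

Lemma Rsum_ge0 (I : Type) (s : seq I) (P : pred I) (F : I -> R) :
  (forall i, P i -> 0 <= F i)%coqR ->
  (0 <= \big[Rplus/0%coqR]_(i <- s | P i) F i)%coqR.
Proof.
move=> F0; apply: (big_ind (fun x => (0 <= x)%coqR)) => //; first lra.
by move=> x y *; lra.
Qed.

Lemma Rsum_le (I : Type) (s : seq I) (P : pred I) (F G : I -> R) :
  (forall i, P i -> F i <= G i)%coqR ->
  (\big[Rplus/0%coqR]_(i <- s | P i) F i <=
   \big[Rplus/0%coqR]_(i <- s | P i) G i)%coqR.
Proof.
move=> FG; apply: (big_ind2 (fun x y => (x <= y)%coqR)) => //; first lra.
by move=> *; lra.
Qed.

(** * Adjoint and real part of the trace *)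

Definition dag m n (A : 'M[C]_(m, n)) : 'M[C]_(n, m) := (map_mx Cconj A)^T.

Lemma dagE m n (A : 'M[C]_(m, n)) i j : dag A i j = Cconj (A j i).
Proof. by rewrite !mxE. Qed.

Lemma dagK m n (A : 'M[C]_(m, n)) : dag (dag A) = A.
Proof. by apply/matrixP=> i j; rewrite !dagE; apply: C_eq; rewrite /=; lra. Qed.

Lemma dag_mulmx m n p (A : 'M[C]_(m, n)) (B : 'M[C]_(n, p)) :
  dag (A *m B) = dag B *m dag A.
Proof. by rewrite /dag map_mxM trmx_mul. Qed.

Lemma dagM n (A B : 'M[C]_n) : dag (A * B) = dag B * dag A.
Proof. exact: dag_mulmx. Qed.

Lemma dagD m n (A B : 'M[C]_(m, n)) : dag (A + B) = dag A + dag B.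
Proof. by rewrite /dag map_mxD linearD. Qed.

Lemma dagB m n (A B : 'M[C]_(m, n)) : dag (A - B) = dag A - dag B.
Proof. by rewrite /dag map_mxB linearB. Qed.

Lemma dag1 n : dag 1 = 1 :> 'M[C]_n.
Proof. by rewrite /dag map_mx1 trmx1. Qed.

Lemma dag0 m n : dag 0 = 0 :> 'M[C]_(m, n).
Proof. by rewrite /dag map_mx0 trmx0. Qed.

Lemma dagZ m n r (A : 'M[C]_(m, n)) : dag (RtoC r *: A) = RtoC r *: dag A.
Proof. by apply/matrixP=> i j; rewrite dagE !mxE rmorphM /= Cconj_real. Qed.

Definition rtr n (A : 'M[C]_n) : R := Re (\tr A).

Lemma rtrD n (A B : 'M[C]_n) : rtr (A + B) = (rtr A + rtr B)%coqR.
Proof. by rewrite /rtr mxtraceD. Qed.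

Lemma rtrZ n r (A : 'M[C]_n) : rtr (RtoC r *: A) = (r * rtr A)%coqR.
Proof. by rewrite /rtr mxtraceZ ReZ. Qed.

Lemma rtrB n (A B : 'M[C]_n) : rtr (A - B) = (rtr A - rtr B)%coqR.
Proof. by rewrite /rtr raddfB. Qed.

Lemma rtr_mulC m n (A : 'M[C]_(m, n)) (B : 'M[C]_(n, m)) :
  rtr (A *m B) = rtr (B *m A).
Proof. by rewrite /rtr mxtrace_mulC. Qed.

Lemma rtrMC n (A B : 'M[C]_n) : rtr (A * B) = rtr (B * A).
Proof. exact: rtr_mulC. Qed.

Lemma rtr_dag n (A : 'M[C]_n) : rtr (dag A) = rtr A.
Proof.
rewrite /rtr /mxtrace !Re_sum; apply: eq_bigr => i _; by rewrite dagE.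
Qed.

Lemma rtr_sum n I (s : seq I) (P : pred I) (F : I -> 'M[C]_n) :
  rtr (\sum_(i <- s | P i) F i) = \big[Rplus/0%coqR]_(i <- s | P i) rtr (F i).
Proof. apply: (big_morph (@rtr n)) => [A B|]; [exact: rtrD|by rewrite /rtr mxtrace0]. Qed.

(** * Positive semidefinite matrices *)

Definition psdm n (A : 'M[C]_n) : Prop :=
  dag A = A /\ forall v : 'cV[C]_n, (0 <= rtr (dag v *m A *m v))%coqR.

Lemma psdD n (A B : 'M[C]_n) : psdm A -> psdm B -> psdm (A + B).
Proof.
move=> [hA pA] [hB pB]; split=> [|v]; first by rewrite dagD hA hB.
by rewrite mulmxDr mulmxDl rtrD; move: (pA v) (pB v); lra.
Qed.

Lemma psdZ n r (A : 'M[C]_n) : (0 <= r)%coqR -> psdm A -> psdm (RtoC r *: A).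
Proof.
move=> r0 [hA pA]; split=> [|v]; first by rewrite dagZ hA.
by rewrite -scalemxAr -scalemxAl rtrZ; apply: Rmult_le_pos.
Qed.

Lemma psd_sum n I (s : seq I) (P : pred I) (F : I -> 'M[C]_n) :
  (forall i, P i -> psdm (F i)) -> psdm (\sum_(i <- s | P i) F i).
Proof.
move=> pF; apply: (big_ind (@psdm n)) => //; last exact: psdD.
split=> [|v]; first exact: dag0.
by rewrite mulmx0 mul0mx /rtr mxtrace0 /=; lra.
Qed.

Lemma psd_congr m n (A : 'M[C]_n) (B : 'M[C]_(n, m)) :
  psdm A -> psdm (dag B *m A *m B).
Proof.
move=> [hA pA]; split=> [|v]; first by rewrite !dag_mulmx hA dagK mulmxA.
by have := pA (B *m v); rewrite dag_mulmx !mulmxA.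
Qed.

Lemma psd_congr_herm n (A B : 'M[C]_n) :
  dag B = B -> psdm A -> psdm (B * A * B).
Proof. by move=> hB pA; have := psd_congr B pA; rewrite hB. Qed.

Lemma dag_delta m n (i : 'I_m) (j : 'I_n) : dag (delta_mx i j) = delta_mx j i.
Proof. by apply/matrixP=> k l; rewrite dagE !mxE rmorph_nat andbC. Qed.

Lemma delta_form n (A : 'M[C]_n) i j :
  \tr (delta_mx 0 i *m A *m (delta_mx j 0 : 'cV_n)) = A i j.
Proof. by rewrite -rowE -colE /mxtrace big_ord1 !mxE. Qed.

Lemma psd_diag_ge0 n (A : 'M[C]_n) i : psdm A -> (0 <= Re (A i i))%coqR.
Proof. by case=> _ /(_ (delta_mx i 0)); rewrite dag_delta /rtr delta_form. Qed.

Lemma psd_rtr_ge0 n (A : 'M[C]_n) : psdm A -> (0 <= rtr A)%coqR.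
Proof.
by move=> pA; rewrite /rtr Re_sum; apply: Rsum_ge0 => i _; exact: psd_diag_ge0.
Qed.

Lemma psd1 n : psdm (1 : 'M[C]_n).
Proof.
split=> [|v]; first exact: dag1.
rewrite mulmx1 /rtr Re_sum; apply: Rsum_ge0 => i _.
rewrite mxE Re_sum; apply: Rsum_ge0 => j _.
by rewrite dagE /=; nra.
Qed.

Lemma psd_gram n (A : 'M[C]_n) : psdm (dag A * A).
Proof. by have := psd_congr A (psd1 n); rewrite mulmx1. Qed.

(** If [A i j] were nonzero, moving from [e_j] far enough along [e_i] would make the quadratic form
    negative, since no quadratic term in [A i i] compensates. *)
Lemma psd_row0 n (A : 'M[C]_n) i j : psdm A -> A i i = 0 -> A i j = 0.
Proof.
move=> [hA pA] A0.
(* The form at [e_j + a e_i]: its term in [|a|^2] carries [A i i = 0], so it is affine in [a]. *)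
have test (a : C) : (0 <= Re (A j j) + 2 * Re (Cconj a * A i j)%R)%coqR.
  have hji : A j i = Cconj (A i j) by rewrite -dagE hA.
  have -> : (Re (A j j) + 2 * Re (Cconj a * A i j)%R)%coqR =
            Re (A j j + a * A j i + (Cconj a * A i j + Cconj a * a * A i i)).
    rewrite hji A0 mulr0 addr0 !ReD.
    by case: (A i j) (a) => [x y] [x' y']; rewrite /Cconj /GRing.mul /=; lra.
  have := pA (delta_mx j 0 + a *: delta_mx i 0).
  have -> : dag (delta_mx j 0 + a *: delta_mx i 0) =
            delta_mx 0 j + Cconj a *: delta_mx 0 i :> 'rV_n.
    by apply/matrixP=> k l; rewrite dagE !mxE rmorphD rmorphM !rmorph_nat !(andbC _ (k == 0)).
  rewrite !mulmxDl !mulmxDr -!scalemxAl -!scalemxAr /rtr.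
  by rewrite !mxtraceD !mxtraceZ !delta_form !mulrA.
set N := (Re (A i j) * Re (A i j) + Im (A i j) * Im (A i j))%coqR.
have [N0|N0] : (N = 0 \/ 0 < N)%coqR by rewrite /N; nra.
  by apply: C_eq; rewrite /= ; move: N0; rewrite /N; nra.
(* Chosen so that [test] at [a = - s A i j] reads [0 <= A j j - 2 s N = -1]. *)
pose s := ((Re (A j j) + 1) / (2 * N))%coqR.
have := test (- (RtoC s * A i j)).
have -> : Re (Cconj (- (RtoC s * A i j)) * A i j) = (- (s * N))%coqR.
  by rewrite /N; case: (A i j) => x y; rewrite /Cconj /GRing.mul /GRing.opp /=; lra.
have -> : (s * N = (Re (A j j) + 1) / 2)%coqR by rewrite /s; field; lra.
by lra.
Qed.

Lemma mulmZl n c (A B : 'M[C]_n) : (c *: A) * B = c *: (A * B).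
Proof. by rewrite -!mulmxE scalemxAl. Qed.

Lemma mulmZr n c (A B : 'M[C]_n) : A * (c *: B) = c *: (A * B).
Proof. by rewrite -!mulmxE scalemxAr. Qed.

Lemma herm_diag n (A : 'M[C]_n) i : dag A = A -> A i i = RtoC (Re (A i i)).
Proof.
move=> hA; have := congr1 (fun B : 'M_n => Im (B i i)) hA.
by rewrite dagE /= => h; apply: C_eq; rewrite //=; lra.
Qed.

(* One step of symmetric Gaussian elimination with pivot [k]. *)
Lemma psd_eliminate n (A : 'M[C]_n) k (c := RtoC (/ Re (A k k))%coqR)
    (B := A - c *: (A * delta_mx k k * A)) :
  psdm A -> Re (A k k) <> 0%coqR ->
  [/\ psdm B, B k k = 0 & forall i, A i i = 0 -> B i i = 0].
Proof.
move=> pA Ak0; have hA := pA.1.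
have AkE := herm_diag k hA.
have cA : c * A k k = 1.
  by rewrite AkE -rmorphM; congr RtoC; rewrite /GRing.mul /=; field.
have entry i : B i i = A i i - c * (A i k * A k i).
  have -> : B i i = A i i - c * (A * delta_mx k k * A) i i by do 3 rewrite mxE.
  congr (_ - _ * _).
  rewrite -(mul_delta_mx (0 : 'I_1)) -!mulmxE !mulmxA -colE -mulmxA -rowE.
  by rewrite mxE big_ord1 !mxE.
have EAE : delta_mx k k * A * delta_mx k k = A k k *: delta_mx k k.
  rewrite -(mul_delta_mx (0 : 'I_1)) -!mulmxE.
  rewrite !mulmxA -(mulmxA _ (delta_mx 0 k) A) -(mulmxA _ (delta_mx 0 k *m A)).
  rewrite [X in _ *m X *m _]mx11_scalar -trace_mx11 delta_form.
  by rewrite mul_mx_scalar -scalemxAl.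
split.
(* [B] is the congruence of [A] by [S]: in the expansion, [EAE] and [cA] reduce the quadratic term
   to [c A E A], which cancels one of the two linear terms. *)
- pose S := 1 - c *: (delta_mx k k * A).
  have dS : dag S = 1 - c *: (A * delta_mx k k).
    by rewrite dagB dag1 dagZ dagM hA dag_delta.
  have -> : B = dag S *m A *m S; last exact: psd_congr.
  rewrite mulmxE dS mulrBl mul1r mulmZl /S mulrBr mulr1 mulmZr mulrBl mulmZl.
  have -> : A * delta_mx k k * A * (delta_mx k k * A) =
            A k k *: (A * delta_mx k k * A).
    by rewrite -!mulrA (mulrA _ A) (mulrA _ (delta_mx k k)) EAE mulmZl mulmZr.
  by rewrite scalerA cA scale1r mulrA subrr scaler0 subr0.
- by rewrite entry mulrA cA mul1r subrr.
- by move=> i Ai0; rewrite entry Ai0 (psd_row0 _ pA Ai0) mul0r mulr0 subrr.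
Qed.

(** Avoids square roots and spectral theory: elimination peels off terms [c A E A] with [c > 0],
    each having nonnegative trace against [B], until the diagonal of [A] vanishes and with it [A].
    The induction is on [d], where only the last [d] diagonal entries may be nonzero. *)
Lemma psd_rtrM_ge0 n (A B : 'M[C]_n) :
  psdm A -> psdm B -> (0 <= rtr (A * B)%R)%coqR.
Proof.
move=> + pB; suff H d : forall A : 'M[C]_n, psdm A ->
    (forall i : 'I_n, (i + d < n)%N -> A i i = 0) -> (0 <= rtr (A * B)%R)%coqR.
  by move=> pA; apply: (H n) => // i; rewrite ltnNge leq_addl.
elim: d {A} => [|d IH] A pA diag0.
  suff -> : A = 0 by rewrite mul0r /rtr mxtrace0 /=; lra.
  by apply/matrixP=> i j; rewrite mxE; apply: psd_row0 => //; apply: diag0; rewrite addn0.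
have [lt_dn|le_nd] := ltnP d n; last first.
  by apply: IH => // i; rewrite ltnNge (leq_trans le_nd) ?leq_addl.
(* The pivot is the first diagonal position not yet known to vanish. *)
have kP : (n - d.+1 < n)%N by rewrite ltn_subrL (leq_ltn_trans _ lt_dn).
pose k := Ordinal kP.
have before (i : 'I_n) : (i + d < n)%N -> i = k \/ A i i = 0.
  rewrite leq_eqVlt => /orP[/eqP e|lt_i]; last by right; apply: diag0; rewrite addnS.
  by left; apply/val_inj/eqP; rewrite -(eqn_add2r d.+1) subnK // addnS e.
have [Ak0|Ak0] := Req_dec (Re (A k k)) 0.
  apply: IH => // i /before[->|//]; rewrite herm_diag ?Ak0; by [case: pA|].
have [pA' A'k A'i] := psd_eliminate pA Ak0.
(* With [E] the diagonal matrix unit at [k], cyclicity and [E E = E] turn this trace into that of a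
   congruence of [B]. *)
have lead : (0 <= rtr (A * delta_mx k k * A * B)%R)%coqR.
  have -> : rtr (A * delta_mx k k * A * B) =
            rtr (dag (delta_mx k k) *m (dag A *m B *m A) *m delta_mx k k).
    rewrite dag_delta rtr_mulC !mulmxA mul_delta_mx pA.1 !mulmxE.
    by rewrite -!mulrA [LHS]rtrMC -!mulrA.
  by apply: psd_rtr_ge0; do 2 apply: psd_congr.
have main := IH _ pA' _.
have {main} : (0 <= rtr ((A - RtoC (/ Re (A k k))%coqR *: (A * delta_mx k k * A)) * B)%R)%coqR.
  by apply: main => i /before[->//|/A'i].
have /Rmult_le_pos /(_ lead) : (0 <= / Re (A k k))%coqR.
  by apply/Rlt_le/Rinv_0_lt_compat; have := psd_diag_ge0 k pA; lra.
by rewrite mulrBl mulmZl rtrB rtrZ => ? h; apply: Rle_trans (Rge_le _ _ (Rminus_ge _ _ (Rle_ge _ _ h))).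
Qed.

(** Since [B ^ (i+2) = B (B ^ i) B] is a congruence, positivity propagates in steps of two; the
    induction carries two consecutive exponents. *)
Lemma psd_exp n (B : 'M[C]_n) j : psdm B -> psdm (B ^+ j).
Proof.
move=> pB; have [hB _] := pB.
have two i : psdm (B ^+ i) -> psdm (B ^+ i.+2).
  by rewrite exprS exprSr mulrA; exact: psd_congr_herm.
suff: psdm (B ^+ j) /\ psdm (B ^+ j.+1) by case.
elim: j => [|j [IH0 IH1]]; first by rewrite expr0 expr1; split=> //; exact: psd1.
by split=> //; exact: two.
Qed.

(* Operator version of [a >= r -> a ^ k >= r ^ k] on the range of [P]; the powers
   of [A - r P] are positive, so no functional calculus is needed. *)
Lemma exp_ge_scaled_projector n (P B : 'M[C]_n) r k (A := B + RtoC r *: P) :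
  dag P = P -> P * P = P -> psdm B -> P * B = B -> B * P = B ->
  (0 <= r)%coqR ->
  psdm (A ^+ k * P - RtoC (r ^ k)%coqR *: P).
Proof.
move=> hP PP pB PB BP r0.
have PA : P * A = A by rewrite mulrDr PB mulmZr PP.
have AP : A * P = A by rewrite mulrDl BP mulmZl PP.
have PAP i : P * A ^+ i * P = A ^+ i * P.
  have -> : P * A ^+ i = A ^+ i * P by apply: commrX; rewrite /GRing.comm PA AP.
  by rewrite -mulrA PP.
have pP : psdm P by have := psd_gram P; rewrite hP PP.
(* Expanding one factor [A = B + r P] raises the power of [B], so the induction on [i] must cover
   every [j]. *)
have pBA : forall i j, psdm (B ^+ j * (A ^+ i * P)).
  elim=> [|i IH] j.
    rewrite expr0 mul1r; case: j => [|j]; first by rewrite expr0 mul1r.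
    by rewrite exprSr -mulrA BP -exprSr; exact: psd_exp.
  have -> : B ^+ j * (A ^+ i.+1 * P) =
      B ^+ j.+1 * (A ^+ i * P) + RtoC r *: (B ^+ j * (A ^+ i * P)).
    rewrite exprS -(mulrA A) {1}/A mulrDl mulmZl mulrDr mulmZr.
    by rewrite (mulrA P) PAP exprSr -!mulrA.
  by apply: psdD => //; exact: psdZ.
elim: k => [|k IH].
  rewrite expr0 mul1r /= scale1r subrr -(scale0r P).
  by apply: (psdZ (r := 0)) => //; lra.
(* Splitting off one factor [A] leaves the product [B A^k P], positive by [pBA], plus [r] times the
   previous difference. *)
have -> : A ^+ k.+1 * P - RtoC (r ^ k.+1)%coqR *: P =
    B ^+ 1 * (A ^+ k * P) + RtoC r *: (A ^+ k * P - RtoC (r ^ k)%coqR *: P).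
  rewrite exprS -(mulrA A) {1}/A mulrDl mulmZl (mulrA P) PAP expr1.
  by rewrite scalerBr scalerA -rmorphM addrA.
by apply: psdD => //; exact: psdZ.
Qed.

Lemma bernoulli_le q k : (0 <= q <= 1)%coqR -> (1 - INR k * q <= (1 - q) ^ k)%coqR.
Proof.
move=> q01; elim: k => [|k IH]; first by rewrite /=; lra.
by rewrite S_INR /=; have := pos_INR k; nra.
Qed.

(* Cauchy-Schwarz for [rho] and convexity of the square, in linearised form. *)
Lemma success_linearized n (A rho : 'M[C]_n) t :
  psdm rho -> rtr rho = 1%coqR ->
  (2 * t * rtr (A * rho)%R - t ^ 2 <= rtr (dag A * A * rho)%R)%coqR.
Proof.
move=> prho tr1; have := psd_rtr_ge0 (psd_congr (dag (A - RtoC t *: (1 : 'M_n))) prho).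
rewrite dagK dagB dagZ dag1 mulmxE mulrBl mulrBr !mulrBl !mulmZl !mulmZr !mul1r !mulr1.
rewrite !rtrB !rtrZ tr1.
have -> : rtr (rho * dag A) = rtr (A * rho) by rewrite -rtr_dag dagM dagK prho.1.
rewrite (rtrMC (A * rho)) mulrA.
by set x := rtr (A * rho); set y := rtr (dag A * A * rho); nra.
Qed.

(** * Expectation over independent codewords *)

(** Pads the product with identities up to all [M] positions, the shape in which the expectation
    factorizes. *)
Lemma prod_prefix_rcons (K : pzRingType) M m (u : 'I_M -> K) (v : K) :
  (m < M)%N ->
  (\prod_(k < M | (k < m)%N) u k) * v =
  \prod_(k < M) (if (k < m)%N then u k else if k == m :> nat then v else 1).
Proof.
rewrite big_mkcond /=.
elim: M u => [//|M IH] u; rewrite ltnS leq_eqVlt => /orP[/eqP->|lt_mM].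
  rewrite !big_ord_recr /= ltnn eqxx mulr1; congr (_ * _).
  by apply: eq_bigr => i _; rewrite /= ltn_ord.
by rewrite !big_ord_recr /= ltnNge (ltnW lt_mM) gtn_eqF //= !mulr1 IH.
Qed.

Lemma prod_scale n I (s : seq I) (a : I -> C) (F : I -> 'M[C]_n) :
  \prod_(i <- s) (a i *: F i) = (\prod_(i <- s) a i) *: \prod_(i <- s) F i.
Proof.
elim: s => [|i s IH]; first by rewrite !big_nil scale1r.
by rewrite !big_cons IH mulmZl mulmZr scalerA.
Qed.

(** Independence: distributing an ordered product of sums yields one term per code. The order of the
    positions is kept, so the factors need not commute. *)
Lemma expect_prod n (X : finType) (p : X -> R) M (F : 'I_M -> X -> 'M[C]_n) :
  \big[Rplus/0%coqR]_(c : {ffun 'I_M -> X})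
     ((\big[Rmult/1%coqR]_(i < M) p (c i)) * rtr (\prod_(i < M) F i (c i))%R)%coqR =
  rtr (\prod_(i < M) \sum_x RtoC (p x) *: F i x).
Proof.
rewrite bigA_distr_bigA rtr_sum; apply: eq_bigr => c _.
by rewrite prod_scale -(rmorph_prod RtoC) rtrZ.
Qed.

Lemma expect1 (X : finType) (p : X -> R) M : prob_dist p ->
  \big[Rplus/0%coqR]_(c : {ffun 'I_M -> X}) \big[Rmult/1%coqR]_(i < M) p (c i) = 1%coqR.
Proof. by case=> _ p1; rewrite -(bigA_distr_bigA (fun _ => p)) p1 big1. Qed.

Lemma sum_prob_scale n (X : finType) (p : X -> R) (A : 'M[C]_n) : prob_dist p ->
  \sum_x RtoC (p x) *: A = A.
Proof.
by case=> _ p1; rewrite -scaler_suml -(rmorph_sum RtoC) /= [\sum_x _]p1 scale1r.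
Qed.

(** * Operator inequalities from the typicality hypotheses *)

Lemma compl_sandwich n (P rho : 'M[C]_n) : P * P = P -> P * rho = rho * P ->
  (1 - P) * rho * (1 - P) = rho - P * rho.
Proof.
move=> PP comm; rewrite mulrBl mul1r mulrBr mulr1 mulrBl comm -mulrA PP.
by rewrite subrr subr0.
Qed.

Lemma compl_herm n (P : 'M[C]_n) : dag P = P -> dag (1 - P) = 1 - P.
Proof. by move=> hP; rewrite dagB dag1 hP. Qed.

Lemma compl_psd n (P : 'M[C]_n) : dag P = P -> P * P = P -> psdm (1 - P).
Proof.
move=> hP PP; have := psd_gram (1 - P).
by rewrite compl_herm // mulrBl mul1r mulrBr mulr1 PP subrr subr0.
Qed.

(** By commutation [rho] is block diagonal for [P] and [1 - P]. The difference is [d] times the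
    block on the complement plus [d] times the assumed gap on the range of [P]. *)
Lemma projector_le_scaled_state n (P rho : 'M[C]_n) d :
  dag P = P -> P * P = P -> psdm rho -> P * rho = rho * P -> (0 < d)%coqR ->
  psdm (P * rho * P - RtoC (/ d)%coqR *: P) -> psdm (RtoC d *: rho - P).
Proof.
move=> hP PP prho comm d0 lb.
have -> : RtoC d *: rho - P = RtoC d *: ((1 - P) * rho * (1 - P)) +
                             RtoC d *: (P * rho * P - RtoC (/ d)%coqR *: P).
  rewrite compl_sandwich // -scalerDr -(mulrA P) -comm (mulrA P) PP addrA subrK.
  rewrite scalerBr scalerA -(rmorphM RtoC).
  have -> : (d * (/ d)%coqR)%R = 1%coqR by rewrite /GRing.mul /=; field; lra.
  by rewrite scale1r.
by apply: psdD; apply: psdZ; (try exact: Rlt_le) => //;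
  apply: psd_congr_herm => //; exact: compl_herm.
Qed.

(** The difference is a sum of two positive parts: [d (P / D - P rho P)], with [rho] the mean state,
    and the average of [P (d rho_x - Px) P]. *)
Lemma average_complement_ge n (X : finType) (p : X -> R) (P : 'M[C]_n)
    (Px rho : X -> 'M[C]_n) D d :
  prob_dist p -> dag P = P -> P * P = P -> (0 < D)%coqR -> (0 < d)%coqR ->
  (forall x, psdm (RtoC d *: rho x - Px x)) ->
  psdm (RtoC (/ D)%coqR *: P - P * (\sum_x RtoC (p x) *: rho x) * P) ->
  psdm (\sum_x RtoC (p x) *: (P * (1 - Px x) * P) - RtoC (1 - d / D)%coqR *: P).
Proof.
move=> prob hP PP D0 d0 dom ub.
have -> : \sum_x RtoC (p x) *: (P * (1 - Px x) * P) - RtoC (1 - d / D)%coqR *: P =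
    RtoC d *: (RtoC (/ D)%coqR *: P - P * (\sum_x RtoC (p x) *: rho x) * P) +
    \sum_x RtoC (p x) *: (P * (RtoC d *: rho x - Px x) * P).
  have -> : \sum_x RtoC (p x) *: (P * (RtoC d *: rho x - Px x) * P) =
      RtoC d *: (P * (\sum_x RtoC (p x) *: rho x) * P) +
      (\sum_x RtoC (p x) *: (P * (1 - Px x) * P) - P).
    rewrite mulr_sumr mulr_suml scaler_sumr -[X in _ + (_ - X)](sum_prob_scale P prob).
    rewrite -sumrB -big_split /=; apply: eq_bigr => x _.
    rewrite !mulrBr !mulrBl mulr1 PP !mulmZr !mulmZl !scalerBr !scalerA.
    by rewrite addrAC subrr add0r (mulrC (RtoC d)).
  rewrite addrA scalerBr subrK addrCA; congr (_ + _).
  rewrite scalerA -(rmorphM RtoC) -[in X in _ + X](scale1r P) -(rmorph1 RtoC).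
  rewrite -scalerBl -rmorphB -scaleNr -rmorphN; congr (RtoC _ *: _).
  by rewrite /GRing.mul /GRing.opp /GRing.add /GRing.one /= /Rdiv; lra.
apply: psdD; first by apply: psdZ => //; exact: Rlt_le.
apply: psd_sum => x _; apply: psdZ; first by case: prob.
exact: psd_congr_herm.
Qed.

(** A union bound for commuting [Q] and [rho]: expanding the nonnegative trace of
    [(1 - P) (rho - Q rho)] gives [Tr (P Q rho) >= Tr (P rho) + Tr (Q rho) - 1]. *)
Lemma gentle_union n (P Q rho : 'M[C]_n) eps :
  dag P = P -> P * P = P -> dag Q = Q -> Q * Q = Q ->
  psdm rho -> rtr rho = 1%coqR -> Q * rho = rho * Q ->
  (1 - eps <= rtr (P * rho)%R)%coqR -> (1 - eps <= rtr (Q * rho)%R)%coqR ->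
  (1 - 2 * eps <= rtr (P * (Q * rho))%R)%coqR.
Proof.
move=> hP PP hQ QQ prho tr1 comm lP lQ.
have p2 : psdm (rho - Q * rho).
  by rewrite -compl_sandwich //; apply: psd_congr_herm => //; exact: compl_herm.
have := psd_rtrM_ge0 (compl_psd hP PP) p2.
rewrite mulrBl mul1r mulrBr !rtrB tr1; move: lP lQ.
set a := rtr (P * rho); set b := rtr (Q * rho); set c := rtr (P * _); lra.
Qed.

(** * Translation of operators into matrices *)

Definition toM n (A : op n) : 'M[C]_n := \matrix_(i, j) A i j.

Lemma toM_mul n (A B : op n) : toM (mmul A B) = toM A * toM B.
Proof. by apply/matrixP=> i j; rewrite !mxE; apply: eq_bigr => k _; rewrite !mxE. Qed.

Lemma toM_sub n (A B : op n) : toM (msub A B) = toM A - toM B.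
Proof. by apply/matrixP=> i j; rewrite !mxE. Qed.

Lemma toM_scale n r (A : op n) : toM (mscale r A) = RtoC r *: toM A.
Proof. by apply/matrixP=> i j; rewrite !mxE. Qed.

Lemma toM_id n : toM (@mid n) = 1.
Proof. by apply/matrixP=> i j; rewrite !mxE /mid; case: eqP. Qed.

Lemma toM_sandw n (P A : op n) : toM (sandw P A) = toM P * toM A * toM P.
Proof. by rewrite !toM_mul. Qed.

Lemma toM_avg n (X : finType) (p : X -> R) (rho : X -> op n) :
  toM (avg_state p rho) = \sum_x RtoC (p x) *: toM (rho x).
Proof.
rewrite /avg_state (big_morph (@toM n) (id1 := 0) (op1 := +%R)).
- by apply: eq_bigr => x _; rewrite toM_scale.
- by move=> A B; apply/matrixP=> i j; rewrite !mxE.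
- by apply/matrixP=> i j; rewrite !mxE.
Qed.

Lemma trace_toM n (A : op n) : Re (trace A) = rtr (toM A).
Proof. by rewrite /rtr /trace; congr Re; apply: eq_bigr => i _; rewrite mxE. Qed.

Lemma toM_herm n (A : op n) : hermitian A -> dag (toM A) = toM A.
Proof. by move=> hA; apply/matrixP=> i j; rewrite dagE !mxE -hA. Qed.

Lemma toM_psd n (A : op n) : psd A -> psdm (toM A).
Proof.
case=> hA pA; split=> [|v]; first exact: toM_herm.
have -> : rtr (dag v *m toM A *m v) =
          Re (\sum_i \sum_j Cconj (v i 0) * A i j * v j 0).
  rewrite /rtr /mxtrace big_ord1 mxE exchange_big; congr Re; apply: eq_bigr => j _.
  by rewrite mxE mulr_suml; apply: eq_bigr => i _; rewrite dagE mxE.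
exact: (pA (fun i => v i 0)).
Qed.

Lemma toM_projector n (P : op n) : projector P ->
  dag (toM P) = toM P /\ toM P * toM P = toM P.
Proof.
case=> PP hP; split; first exact: toM_herm.
by rewrite -toM_mul; apply/matrixP=> i j; rewrite !mxE PP.
Qed.

Lemma toM_commute n (A B : op n) : commute A B -> toM A * toM B = toM B * toM A.
Proof. by move=> AB; rewrite -!toM_mul; apply/matrixP=> i j; rewrite !mxE AB. Qed.

(** * The sequential decoder and its success on one message *)

Definition seq_fail n (X : finType) (P : 'M[C]_n) (Px : X -> 'M[C]_n) M
    (c : {ffun 'I_M -> X}) (m : nat) : 'M[C]_n :=
  \prod_(k < M | (k < m)%N) (P * (1 - Px (c k)) * P).

Lemma toM_seq_povm n (X : finType) (Pi : op n) (Pix : X -> op n) M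
    (c : {ffun 'I_M -> X}) (m : 'I_M)
    (L := seq_fail (toM Pi) (fun x => toM (Pix x)) c m) :
  projector Pi -> (forall x, projector (Pix x)) ->
  toM (seq_povm Pi Pix c m) =
  L * (toM Pi * toM (Pix (c m)) * toM Pi) * dag L.
Proof.
move=> /toM_projector[hP _] prPx.
have QE x : toM (sandw Pi (msub (@mid n) (Pix x))) =
            toM Pi * (1 - toM (Pix x)) * toM Pi.
  by rewrite toM_sandw toM_sub toM_id.
rewrite /seq_povm 2!toM_mul toM_sandw; congr (_ * _ * _).
  rewrite (big_morph (@toM n) (@toM_mul n) (toM_id n)).
  by apply: eq_bigr => k _.
(* The reversed product is the adjoint of the direct one because every factor is Hermitian. *)
rewrite -[LHS]dagK; congr dag.
rewrite (big_morph (fun A => dag (toM A)) (id1 := 1) (op1 := *%R)).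
- apply: eq_bigr => k _; rewrite QE !dagM hP compl_herm ?mulrA //.
  by have [] := toM_projector (prPx (c k)).
- by move=> A B; rewrite toM_mul dagM.
- by rewrite toM_id dag1.
Qed.

(** Position by position, the [m] earlier codewords each contribute the mean failure operator,
    codeword [m] contributes the mean of [P Px rho], and later ones average to the identity. *)
Lemma expect_overlap n (X : finType) (p : X -> R) (P : 'M[C]_n)
    (Px rho : X -> 'M[C]_n) M (m : 'I_M) : prob_dist p ->
  \big[Rplus/0%coqR]_(c : {ffun 'I_M -> X})
     ((\big[Rmult/1%coqR]_(i < M) p (c i)) *
      rtr (seq_fail P Px c m * (P * (Px (c m) * rho (c m))))%R)%coqR =
  rtr ((\sum_x RtoC (p x) *: (P * (1 - Px x) * P)) ^+ m *
       (P * \sum_x RtoC (p x) *: (Px x * rho x))).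
Proof.
move=> prob; pose G x := P * (Px x * rho x).
pose F (i : 'I_M) x : 'M[C]_n :=
  if (i < m)%N then P * (1 - Px x) * P else if i == m :> nat then G x else 1.
transitivity (rtr (\prod_(i < M) \sum_x RtoC (p x) *: F i x)).
  rewrite -expect_prod; apply: eq_bigr => c _; congr (_ * rtr _)%coqR.
  rewrite prod_prefix_rcons //; apply: eq_bigr => i _; rewrite /F.
  by case: ifP => // _; case: ifP => // /eqP /val_inj ->.
set A := \sum_x _; congr rtr.
transitivity (\prod_(i < M) (if (i < m)%N then A
     else if i == m :> nat then P * \sum_x RtoC (p x) *: (Px x * rho x) else 1)).
  apply: eq_bigr => i _; rewrite /F; case: ifP => // _; case: ifP => _.
    by rewrite mulr_sumr; apply: eq_bigr => x _; rewrite mulmZr.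
  exact: sum_prob_scale.
rewrite -(prod_prefix_rcons (fun _ => A)) // big_ord_narrow ?(ltnW (ltn_ord m)) //.
by rewrite prodr_const card_ord.
Qed.

Lemma expect_message_ge n (X : finType) (p : X -> R) (rho : X -> op n)
    (Pi : op n) (Pix : X -> op n) (D d eps : R) M (m : 'I_M)
    (t := ((1 - 2 * eps) * (2 - exp (d / D * INR M)))%coqR) :
  prob_dist p -> (forall x, density (rho x)) ->
  projector Pi -> (forall x, projector (Pix x)) ->
  (0 < D)%coqR -> (0 < d)%coqR -> (0 < eps)%coqR -> (eps <= 1 / 2)%coqR ->
  (forall x, Re (trace (mmul Pi (rho x))) >= 1 - eps)%coqR ->
  (forall x, Re (trace (mmul (Pix x) (rho x))) >= 1 - eps)%coqR ->
  (forall x, mle (mscale (/ d) (Pix x)) (sandw (Pix x) (rho x))) ->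
  mle (sandw Pi (avg_state p rho)) (mscale (/ D) Pi) ->
  (forall x, commute (Pix x) (rho x)) ->
  (2 - exp (d / D * INR M) > 0)%coqR ->
  (t ^ 2 <= \big[Rplus/0]_(c : {ffun 'I_M -> X})
     ((\big[Rmult/1]_(i < M) p (c i)) *
      Re (trace (mmul (seq_povm Pi Pix c m) (rho (c m))))))%coqR.
Proof.
move=> prob dens prPi prPix D0 d0 e0 e1 typ1 typ2 lb ub comm exp2.
have [hP PP] := toM_projector prPi.
pose P := toM Pi; pose Px x := toM (Pix x); pose rh x := toM (rho x).
have hPx x : dag (Px x) = Px x by have [] := toM_projector (prPix x).
have PPx x : Px x * Px x = Px x by have [] := toM_projector (prPix x).
have prh x : psdm (rh x) by apply: toM_psd; case: (dens x).
have tr1 x : rtr (rh x) = 1%coqR by rewrite -trace_toM; case: (dens x) => _ ->.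
have cPx x : Px x * rh x = rh x * Px x by exact: toM_commute.
have lb' x : psdm (Px x * rh x * Px x - RtoC (/ d)%coqR *: Px x).
  by have := toM_psd (lb x); rewrite toM_sub toM_scale toM_sandw.
have ub' : psdm (RtoC (/ D)%coqR *: P - P * (\sum_x RtoC (p x) *: rh x) * P).
  by have := toM_psd ub; rewrite toM_sub toM_scale toM_sandw toM_avg.
have gap := average_complement_ge prob hP PP D0 d0
  (fun x => projector_le_scaled_state (hPx x) (PPx x) (prh x) (cPx x) d0 (lb' x)) ub'.
set A := \sum_x RtoC (p x) *: (P * (1 - Px x) * P) in gap.
have PA : P * A = A.
  by rewrite mulr_sumr; apply: eq_bigr => x _; rewrite mulmZr !mulrA PP.
have AP : A * P = A.
  by rewrite mulr_suml; apply: eq_bigr => x _; rewrite mulmZl -!mulrA PP.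
set q := (d / D)%coqR in gap t exp2 *.
have q0 : (0 < q)%coqR by apply: Rdiv_lt_0_compat.
have M1 : (1 <= INR M)%coqR.
  by apply: (le_INR 1); apply/leP; apply: leq_ltn_trans (ltn_ord m).
(* Together with [exp (q M) < 2] this gives [q M < 1]; as [M >= 1], also [q <= 1], so the base
   [1 - q] is nonnegative. *)
have qM : (1 + q * INR M < exp (q * INR M))%coqR.
  by apply: exp_ineq1; have := Rmult_lt_0_compat _ _ q0 (Rlt_le_trans _ _ _ Rlt_0_1 M1); lra.
have q1 : (q <= 1)%coqR by nra.
set sigma := \sum_x RtoC (p x) *: (Px x * rh x).
have psig : psdm sigma.
  apply: psd_sum => x _; apply: psdZ; first by case: prob.
  (* Commutation makes the product symmetric, hence a congruence of the state. *)
  have -> : Px x * rh x = Px x * rh x * Px x by rewrite -mulrA -cPx mulrA PPx.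
  exact: psd_congr_herm.
have trsig : (1 - 2 * eps <= rtr (P * sigma)%R)%coqR.
  rewrite mulr_sumr rtr_sum.
  have -> : (1 - 2 * eps = \big[Rplus/0]_x (p x * (1 - 2 * eps)))%coqR.
    by rewrite -(big_distrl (times := Rmult) (plus := Rplus)) /= (proj2 prob); lra.
  apply: Rsum_le => x _; rewrite mulmZr rtrZ; apply: Rmult_le_compat_l.
    by case: prob.
  apply: gentle_union => //; apply: Rge_le.
  - by have := typ1 x; rewrite trace_toM toM_mul.
  - by have := typ2 x; rewrite trace_toM toM_mul.
have overlap : (t <= rtr (A ^+ m * (P * sigma))%R)%coqR.
  have PB : P * (A - RtoC (1 - q)%coqR *: P) = A - RtoC (1 - q)%coqR *: P.
    by rewrite mulrBr PA mulmZr PP.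
  have BP : (A - RtoC (1 - q)%coqR *: P) * P = A - RtoC (1 - q)%coqR *: P.
    by rewrite mulrBl AP mulmZl PP.
  have r0 : (0 <= 1 - q)%coqR by lra.
  (* The power bound is applied with [B = A - (1 - q) P], so that [B + (1 - q) P] is [A] again, and
     is then paired with the positive [sigma]. *)
  have := psd_rtrM_ge0 (exp_ge_scaled_projector m hP PP gap PB BP r0) psig.
  rewrite subrK mulrBl mulmZl rtrB rtrZ -mulrA.
  set a := rtr (A ^+ m * _); set b := rtr (P * sigma) => h.
  have rm := bernoulli_le m (conj (Rlt_le _ _ q0) q1).
  have mM : (INR m <= INR M)%coqR by apply: le_INR; apply/leP; apply: ltnW.
  (* Chain: [(1 - q)^m >= 1 - m q >= 1 - M q >= 2 - exp (q M)]. *)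
  have s1 : (2 - exp (q * INR M) <= (1 - q) ^ m)%coqR by nra.
  have tb : (1 - 2 * eps <= b)%coqR by exact: trsig.
  have : (t <= (1 - q) ^ m * b)%coqR by rewrite /t; nra.
  lra.
have t0 : (0 <= t)%coqR by rewrite /t; nra.
pose w (c : {ffun 'I_M -> X}) := (\big[Rmult/1]_(i < M) p (c i))%coqR.
pose g (c : {ffun 'I_M -> X}) := rtr (seq_fail P Px c m * (P * (Px (c m) * rh (c m)))).
have w0 c : (0 <= w c)%coqR.
  apply: (big_ind (fun x => (0 <= x)%coqR)); first lra.
  - exact: Rmult_le_pos.
  - by move=> i _; case: prob.
(* The same [t] serves every code, so the linearised bounds average to [2 t E[g] - t^2]; with
   [t >= 0] and [E[g] >= t] this is at least [t^2]. *)
apply: (Rle_trans _ (\big[Rplus/0]_c (w c * (2 * t * g c - t ^ 2)))%coqR).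
  have -> : (\big[Rplus/0]_c (w c * (2 * t * g c - t ^ 2)) =
     2 * t * (\big[Rplus/0]_c (w c * g c)) + - t ^ 2 * (\big[Rplus/0]_c w c))%coqR.
    rewrite !(big_distrr (times := Rmult) (plus := Rplus)) /= -big_split /=.
    by apply: eq_bigr => c _; lra.
  rewrite (expect1 _ prob) (expect_overlap _ _ _ _ prob) -/A -/sigma.
  by move: overlap; set a := rtr _; nra.
apply: Rsum_le => c _; apply: Rmult_le_compat_l; first exact: w0.
rewrite trace_toM toM_mul toM_seq_povm // -/P -/(Px _) -/(rh _).
set L := seq_fail _ _ _ _.
have := success_linearized (Px (c m) * P * dag L) t (prh (c m)) (tr1 (c m)).
(* Taking the adjoint and cycling the trace moves the failure product to the front, where
   [expect_overlap] applies. *)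
have -> : rtr (Px (c m) * P * dag L * rh (c m)) = g c.
  rewrite -rtr_dag !dagM dagK hPx hP (prh _).1 /g -/L -rtrMC.
  by rewrite !mulrA rtrMC.
(* Idempotence of [Px] identifies the Gram matrix of [Px P L^H] with the decoding operator
   [L P Px P L^H]. *)
rewrite !dagM dagK hPx hP; congr (_ <= rtr _)%coqR.
by rewrite !mulrA -(mulrA _ (Px _) (Px _)) PPx.
Qed.

(* Averaging over the messages *)
Local Close Scope ring_scope.
Local Open Scope R_scope.

Theorem theorem1 (n : nat) (X : finType) (p : X -> R) (rho : X -> op n)
    (Pi : op n) (Pix : X -> op n) (D d eps : R) (M : nat) :
  prob_dist p ->
  (forall x, density (rho x)) ->
  projector Pi ->
  (forall x, projector (Pix x)) ->
  0 < D -> 0 < d -> 0 < eps -> eps <= 1 / 2 ->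
  (forall x, Re (trace (mmul Pi (rho x))) >= 1 - eps) ->
  (forall x, Re (trace (mmul (Pix x) (rho x))) >= 1 - eps) ->
  (forall x, mle (mscale (/ d) (Pix x)) (sandw (Pix x) (rho x))) ->
  mle (sandw Pi (avg_state p rho)) (mscale (/ D) Pi) ->
  (forall x, commute (Pix x) (rho x)) ->
  (0 < M)%nat ->
  2 - exp (d / D * INR M) > 0 ->
  expect_code p (psucc Pi Pix rho (M:=M))
    >= (Rabs ((1 - 2 * eps) * (2 - exp (d / D * INR M)))) ^ 2.
Proof.
move=> prob dens prPi prPix D0 d0 e0 e1 typ1 typ2 lb ub comm M0 exp2.
apply: Rle_ge; rewrite pow2_abs.
set t := (_ * _)%coqR.
have MR : 0 < INR M by apply: lt_0_INR; apply/ltP.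
have -> : expect_code p (psucc Pi Pix rho (M:=M)) =
  / INR M * \big[Rplus/0]_(m < M) \big[Rplus/0]_(c : {ffun 'I_M -> X})
     ((\big[Rmult/1]_(i < M) p (c i)) *
      Re (trace (mmul (seq_povm Pi Pix c m) (rho (c m))))).
  rewrite exchange_big (big_distrr (times := Rmult) (plus := Rplus)) /=.
  apply: eq_bigr => c _.
  rewrite /psucc -(big_distrr (times := Rmult) (plus := Rplus)) /=; lra.
(* The constant is written as a mean over messages so that the comparison becomes termwise. *)
have -> : t ^ 2 = / INR M * \big[Rplus/0]_(m < M) t ^ 2.
  have -> : \big[Rplus/0]_(m < M) t ^ 2 = INR M * t ^ 2.
    rewrite big_const_ord; elim: (M) => [|k IH]; first by rewrite /=; lra.
    by rewrite iterS IH S_INR; lra.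
  by field; lra.
apply: Rmult_le_compat_l; first by apply/Rlt_le/Rinv_0_lt_compat.
by apply: Rsum_le => m _; apply: expect_message_ge.
Qed.
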